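(* Let $P$ be a polytope, $\pi:P\to\pi(P)$ an affine projection, and $k\ge0$ an integer. If all $k$-faces of $P$ are strictly preserved by $\pi$, then all $k$-faces of $\pi(P)$ arise as images of $k$-faces of $P$.
   Context: A nonempty face $F$ of a polytope $P$ is strictly preserved by an affine projection $\pi$ if (i) $\pi(F)$ is a face of $\pi(P)$ combinatorially equivalent to $F$ (isomorphic face lattices), and (ii) $\pi^{-1}(\pi(F))=F$ (preimage in $P$). A $k$-face is a face of dimension $k$. *)

(* Defs.v *)
From HB Require Import structures.
From mathcomp Require Import all_boot all_order all_algebra.
From mathcomp Require Import all_classical all_reals.

Set Implicit Arguments.
Unset Strict Implicit.
Unset Printing Implicit Defensive.

Import Order.TTheory GRing.Theory Num.Theory.

Local Open Scope classical_set_scope.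
Local Open Scope ring_scope.

Definition affine_hull (R : realType) (d : nat) (A : set 'rV[R]_d) :
    set 'rV[R]_d :=
  [set x | exists n (v : 'I_n -> 'rV[R]_d) (a : 'I_n -> R),
    [/\ forall i, A (v i), \sum_i a i = 1 & x = \sum_i a i *: v i]].

Definition convex_hull (R : realType) (d : nat) (A : set 'rV[R]_d) :
    set 'rV[R]_d :=
  [set x | exists n (v : 'I_n -> 'rV[R]_d) (a : 'I_n -> R),
    [/\ forall i, A (v i), forall i, 0 <= a i, \sum_i a i = 1
      & x = \sum_i a i *: v i]].

(* The empty polytope is allowed. *)
Definition polytope (R : realType) (d : nat) (P : set 'rV[R]_d) : Prop :=
  exists2 V : set 'rV[R]_d, finite_set V & P = convex_hull V.

(* Never holds for the empty set, whose affine hull is empty. *)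
Definition has_dim (R : realType) (d : nat) (A : set 'rV[R]_d) (k : nat) :
    Prop :=
  exists (x0 : 'rV[R]_d) (U : {vspace 'rV[R]_d}),
    affine_hull A = [set x | x - x0 \in U] /\ \dim U = k.

(* With c = 0, the choice b = 0 gives Q itself and b = 1 gives set0: both are
   faces of Q. *)
Definition face (R : realType) (d : nat) (Q F : set 'rV[R]_d) : Prop :=
  exists (c : 'cV[R]_d) (b : R),
    (forall x, Q x -> (x *m c) 0 0 <= b) /\
    F = Q `&` [set x | (x *m c) 0 0 = b].

Definition kface (R : realType) (d : nat) (k : nat) (Q F : set 'rV[R]_d) :
    Prop :=
  face Q F /\ has_dim F k.

(* An isomorphism of the face lattices, ordered by inclusion. *)
Definition combinatorially_equivalent (R : realType) (d e : nat)
    (F : set 'rV[R]_d) (G : set 'rV[R]_e) : Prop :=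
  exists phi : set 'rV[R]_d -> set 'rV[R]_e,
    set_bij (face F) (face G) phi /\
    (forall H K, face F H -> face F K -> (phi H `<=` phi K <-> H `<=` K)).

Definition affine_map (R : realType) (d e : nat)
    (f : 'rV[R]_d -> 'rV[R]_e) : Prop :=
  exists (A : 'M[R]_(d, e)) (b : 'rV[R]_e), forall x, f x = x *m A + b.

Definition strictly_preserved (R : realType) (d e : nat)
    (pi : 'rV[R]_d -> 'rV[R]_e) (P F : set 'rV[R]_d) : Prop :=
  [/\ face P F, F !=set0,
      face (pi @` P) (pi @` F) /\ combinatorially_equivalent F (pi @` F)
    & P `&` (pi @^-1` (pi @` F)) = F].

(* Main.v *)
Require Import Defs.
From mathcomp Require Import all_boot all_order all_algebra.
From mathcomp Require Import all_classical all_reals.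
From mathcomp Require Import lra.

(* The preimage F' in P of a k-face G of pi(P) is a face of P of dimension at
   least k, hence has a k-face F, which is also a k-face of P. Since F and
   pi(F) have isomorphic face lattices, a chain of faces of F with one face in
   each dimension 0, ..., k gives a chain of the same length in pi(F), so
   dim pi(F) = k. Thus pi(F) is a face of pi(P) lying in G and of the same
   dimension as G, whence pi(F) = G. The k-faces and the chains come from the
   existence of facets: a supporting hyperplane of a nonempty face of
   codimension at least 2 can be rotated about that face until it hits a new
   vertex. *)

Set Implicit Arguments.
Unset Strict Implicit.
Unset Printing Implicit Defensive.

Import Order.TTheory GRing.Theory Num.Theory.

Local Open Scope classical_set_scope.
Local Open Scope ring_scope.

(** * Linear forms on affine and convex hulls *)

Section LinearForms.
Variables (R : realType) (d : nat).
Implicit Types (c : 'cV[R]_d) (x y : 'rV[R]_d) (A : set 'rV[R]_d).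

Lemma lformD c x y : ((x + y) *m c) 0 0 = (x *m c) 0 0 + (y *m c) 0 0.
Proof. by rewrite mulmxDl mxE. Qed.

Lemma lform_sum c n (a : 'I_n -> R) (v : 'I_n -> 'rV[R]_d) :
  ((\sum_i a i *: v i) *m c) 0 0 = \sum_i a i * (v i *m c) 0 0.
Proof.
rewrite mulmx_suml summxE; apply: eq_bigr => i _.
by rewrite -scalemxAl mxE.
Qed.

Lemma lform_pencil c c' (t : R) x :
  (x *m (c + t *: c')) 0 0 = (x *m c) 0 0 + t * (x *m c') 0 0.
Proof. by rewrite mulmxDr -scalemxAr !mxE. Qed.

(** [U] is the row space of a matrix [M], and a row vector lies in it exactly when [cokermx M] kills
    it, so some column of [cokermx M] is the required form. *)
Lemma lform_sep (U : {vspace 'rV[R]_d}) x : x \notin U ->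
  exists c, (forall u, u \in U -> (u *m c) 0 0 = 0) /\ (x *m c) 0 0 != 0.
Proof.
move=> xU; pose M : 'M[R]_(\dim U, d) := \matrix_i (vbasis U)`_i.
have xM : ~~ (x <= M)%MS.
  apply: contra xU => /submxP[D ->]; rewrite mulmx_sum_row.
  apply: memv_suml => i _; apply: memvZ; rewrite rowK.
  by apply: vbasis_mem; rewrite mem_nth// size_tuple.
have UM u : u \in U -> (u <= M)%MS.
  move=> /coord_vbasis ->; apply: summx_sub => i _; apply: scalemx_sub.
  by rewrite -(rowK (fun i : 'I_(\dim U) => (vbasis U)`_i)) row_sub.
move: xM; rewrite submxE => /matrix0Pn[i [j]]; rewrite ord1 => xj.
have entry z : (z *m col j (cokermx M)) 0 0 = (z *m cokermx M) 0 j.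
  by rewrite !mxE; apply: eq_bigr => l _; rewrite mxE.
exists (col j (cokermx M)); split => [u /UM|]; last by rewrite entry.
by rewrite submxE entry => /eqP ->; rewrite mxE.
Qed.

Lemma lform_affine_hull c (b : R) A :
  (forall x, A x -> (x *m c) 0 0 = b) ->
  forall x, affine_hull A x -> (x *m c) 0 0 = b.
Proof.
move=> cA x [n [v [a [vA a1 ->]]]]; rewrite lform_sum.
under eq_bigr => i _ do rewrite cA//.
by rewrite -mulr_suml a1 mul1r.
Qed.

Lemma lform_convex_hull c (b : R) A :
  (forall x, A x -> (x *m c) 0 0 <= b) ->
  forall x, convex_hull A x -> (x *m c) 0 0 <= b.
Proof.
move=> cA x [n [v [a [vA a0 a1 ->]]]]; rewrite lform_sum.
rewrite -[leRHS]mul1r -a1 mulr_suml; apply: ler_sum => i _.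
by rewrite ler_wpM2l// cA.
Qed.

Lemma convex_hull_face c (b : R) A :
  (forall x, A x -> (x *m c) 0 0 <= b) ->
  convex_hull A `&` [set x | (x *m c) 0 0 = b]
    = convex_hull (A `&` [set x | (x *m c) 0 0 = b]).
Proof.
move=> cA; apply/seteqP; split => x.
- move=> [[n [v [a [vA a0 a1 ->]]]]] /=; rewrite lform_sum => xb.
  have av i : a i != 0 -> (v i *m c) 0 0 = b.
    move=> ai0; have : \sum_i a i * (b - (v i *m c) 0 0) = 0.
      under eq_bigr => j _ do rewrite mulrBr.
      by rewrite sumrB xb -mulr_suml a1 mul1r subrr.
    move/eqP; rewrite psumr_eq0; last first.
      by move=> j _; rewrite mulr_ge0// subr_ge0 cA.
    move=> /allP/(_ i (mem_index_enum _)) /=.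
    by rewrite mulf_eq0 (negPf ai0) /= subr_eq0 => /eqP.
  (* A point of nonzero weight lies on the hyperplane; it replaces every point of weight zero, which
     may lie off it. *)
  have [i ai0] : exists i, a i != 0.
    apply: contrapT => /forallNP aN; move/eqP: a1.
    rewrite big1 => [|i _]; first by rewrite eq_sym oner_eq0.
    by have /negP := aN i; rewrite negbK => /eqP.
  exists n, (fun j => if a j == 0 then v i else v j), a; split => //.
    by move=> j; case: eqP => [_|/eqP aj]; split => //=; apply: av.
  by apply: eq_bigr => j _; case: eqP => // ->; rewrite !scale0r.
- move=> [n [v [a [vA a0 a1 ->]]]]; split.
    by exists n, v, a; split => // i; have [] := vA i.
  rewrite /= lform_sum; under eq_bigr => i _ do rewrite (vA i).2.
  by rewrite -mulr_suml a1 mul1r.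
Qed.

Lemma sub_convex_hull A : A `<=` convex_hull A.
Proof.
move=> x Ax; exists 1%N, (fun=> x), (fun=> 1); split => //.
  by rewrite big_ord1.
by rewrite big_ord1 scale1r.
Qed.

Lemma sub_affine_hull A : A `<=` affine_hull A.
Proof.
move=> x Ax; exists 1%N, (fun=> x), (fun=> 1); split => //.
  by rewrite big_ord1.
by rewrite big_ord1 scale1r.
Qed.

Lemma affine_hullS A B : A `<=` B -> affine_hull A `<=` affine_hull B.
Proof.
by move=> AB x [n [v [a [vA a1 ->]]]]; exists n, v, a; split => // i; apply: AB.
Qed.

Lemma sub_convex_affine_hull A : convex_hull A `<=` affine_hull A.
Proof. by move=> x [n [v [a [vA _ a1 ->]]]]; exists n, v, a. Qed.

End LinearForms.

(** * Dimension, faces and facets of polytopes *)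

Section Dimension.
Variables (R : realType) (d : nat).
Implicit Types (A B P Q F : set 'rV[R]_d).

Lemma has_dim_nonempty A k : has_dim A k -> A !=set0.
Proof.
move=> [x0 [U [AU _]]].
have : affine_hull A x0 by rewrite AU /= subrr mem0v.
move=> [[|n] [v [a [vA a1 _]]]]; last by exists (v ord0).
by move/eqP: a1; rewrite big_ord0 eq_sym oner_eq0.
Qed.

Lemma flat_sub (x y : 'rV[R]_d) (U V : {vspace 'rV[R]_d}) :
  [set z | z - x \in U] `<=` [set z | z - y \in V] ->
  x - y \in V /\ (U <= V)%VS.
Proof.
move=> UV; have xy : x - y \in V by apply: UV; rewrite /= subrr mem0v.
split => //; apply/subvP => u uU.
have /= := UV (u + x); rewrite addrK => /(_ uU).
by rewrite -addrA => uV; rewrite -(addrK (x - y) u) memvB.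
Qed.

Lemma has_dim_le A B k l :
  A `<=` B -> has_dim A k -> has_dim B l -> (k <= l)%N.
Proof.
move=> /affine_hullS AB [x [U [AU <-]]] [y [V [BV <-]]].
move: AB; rewrite AU BV => /flat_sub[_]; exact: dimvS.
Qed.

Lemma affine_hull_eq A B k :
  A `<=` B -> has_dim A k -> has_dim B k -> affine_hull A = affine_hull B.
Proof.
move=> /affine_hullS AB [x [U [AU Uk]]] [y [V [BV Vk]]].
apply/seteqP; split=> //; move: AB; rewrite AU BV => /flat_sub[xy UV] z /= zy.
have -> : U = V by apply/eqP; rewrite eqEdim UV Uk Vk leqnn.
by rewrite -(subrKA y) memvD// -opprB memvN.
Qed.

Lemma face_sub Q F : face Q F -> F `<=` Q.
Proof. by move=> [c [b [_ ->]]] x []. Qed.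

(** Nested sets of equal dimension have the same affine hull, and the equation cutting out [F] holds
    on all of it. *)
Lemma face_dim_sub Q F A k : face Q F -> F `<=` A -> A `<=` Q ->
  has_dim F k -> has_dim A k -> A `<=` F.
Proof.
move=> [c [b [_ ->]]] FA AQ Fk Ak x Ax; split; first exact: AQ.
apply: (@lform_affine_hull _ _ c b (Q `&` [set x | (x *m c) 0 0 = b])).
  by move=> y [].
by rewrite (affine_hull_eq FA Fk Ak); apply: sub_affine_hull.
Qed.

Lemma face_refl P : face P P.
Proof.
exists 0, 0; split => [x _|]; first by rewrite mulmx0 mxE.
by apply/seteqP; split => [x Px|x []//]; split => //=; rewrite mulmx0 mxE.
Qed.

Lemma face_set0 P : face P set0.
Proof.
exists 0, 1; split => [x _|]; first by rewrite mulmx0 mxE ler01.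
apply/seteqP; split => // x [_] /=.
by rewrite mulmx0 mxE => /eqP; rewrite eq_sym oner_eq0.
Qed.

Lemma polytope_face P F : polytope P -> face P F -> polytope F.
Proof.
move=> [V fV ->] [c [b [cb ->]]].
exists (V `&` [set x | (x *m c) 0 0 = b]); first exact: finite_setIl.
by apply: convex_hull_face => x Vx; apply/cb/sub_convex_hull.
Qed.

Lemma polytope_range P : polytope P ->
  exists n (v : 'I_n -> 'rV[R]_d), P = convex_hull (range v).
Proof.
move=> [V /finite_seqP[s ->] ->]; exists (size s), (fun i => s`_i).
congr convex_hull; apply/seteqP; split => x /=.
  by move=> /(nthP 0)[i si <-]; exists (Ordinal si).
by move=> [i _ <-]; rewrite mem_nth.
Qed.

Lemma polytope_has_dim P : polytope P -> P !=set0 -> exists k, has_dim P k.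
Proof.
move=> /polytope_range[n [v ->]] [_ [m [w [a [wv _ a1 _]]]]].
have [i0] : exists i0 : 'I_n, True.
  case: m => [|m] in w a wv a1 *; last by have [i _ _] := wv ord0; exists i.
  by move/eqP: a1; rewrite big_ord0 eq_sym oner_eq0.
move=> _ {m w a wv a1}.
pose s := [tuple v i - v i0 | i < n]; pose U := <<s>>%VS.
exists (\dim U), (v i0), U; split => //.
have sU i : v i - v i0 \in U.
  by apply/memv_span/mapP; exists i => //; rewrite mem_enum.
have comb m (w : 'I_m -> 'rV[R]_d) (a : 'I_m -> R) : \sum_i a i = 1 ->
    \sum_i a i *: w i - v i0 = \sum_i a i *: (w i - v i0).
  move=> a1; under [RHS]eq_bigr => i _ do rewrite scalerBr.
  by rewrite sumrB -scaler_suml a1 scale1r.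
apply/seteqP; split => x /=.
- move=> [m [w [a [wP a1 ->]]]]; rewrite comb//.
  apply: memv_suml => j _; apply: memvZ.
  have [p [y [e [yv _ e1 ->]]]] := wP j; rewrite comb//.
  by apply: memv_suml => l _; apply: memvZ; have [i _ <-] := yv l.
- move=> /coord_span xE; pose a i := coord s i (x - v i0).
  (* The base point [v i0] takes the weight that makes the total 1; its difference vector is
     zero. *)
  exists n, v, (fun i => a i + (if i == i0 then 1 - \sum_j a j else 0)); split.
  + by move=> i; apply: sub_convex_hull; exists i.
  + by rewrite big_split /= -big_mkcond big_pred1_eq addrC subrK.
  + rewrite -[LHS](subrK (v i0)) xE.
    under [RHS]eq_bigr => i _ do rewrite scalerDl.
    rewrite big_split /= [X in _ = _ + X](bigD1 i0)//= eqxx.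
    rewrite [X in _ + (_ + X)]big1 ?addr0; last first.
      by move=> i /negPf ->; rewrite scale0r.
    rewrite scalerBl scale1r scaler_suml [X in _ = _ + X]addrC addrA -sumrB.
    congr (_ + _); apply: eq_bigr => i _.
    by rewrite (nth_map i) ?size_enum_ord// nth_ord_enum scalerBr.
Qed.

(* The form [N c + c'] with [N] large selects the face lexicographically. *)
Lemma face_trans P F H : polytope P -> face P F -> face F H -> face P H.
Proof.
move=> /polytope_range[n [v ->]] [c [b [cb FE]]] [c' [b' [cb' HE]]].
have vP i : convex_hull (range v) (v i) by apply: sub_convex_hull; exists i.
pose g i := b' - (v i *m c') 0 0; pose h i := b - (v i *m c) 0 0.
have h0 i : 0 <= h i by rewrite subr_ge0 cb.
have gF i : h i = 0 -> 0 <= g i.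
  move=> hi; rewrite subr_ge0; apply: cb'; rewrite FE; split => //=.
  by apply/esym/eqP; rewrite -subr_eq0 -/(h i) hi.
(* Whenever [h i > 0], this gives [N * h i >= h i + |g i|], which exceeds [- g i]. Terms with
   [h i = 0] contribute 0, since division by zero yields 0. *)
pose N := 1 + \sum_i `|g i| / h i.
have gN i : 0 < h i -> 0 < N * h i + g i.
  move=> hi; have : `|g i| / h i <= \sum_i `|g i| / h i.
    rewrite (bigD1 i)//= lerDl sumr_ge0// => j _.
    by rewrite divr_ge0.
  rewrite ler_pdivrMr// /N mulrDl mul1r => gi.
  by have := ler_norm (- g i); rewrite normrN; lra.
have hN i : 0 <= N * h i + g i.
  have := h0 i; rewrite le_eqVlt => /orP[/eqP hi|/gN/ltW//].
  by rewrite -hi mulr0 add0r gF.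
have valid x : range v x -> (x *m (c' + N *: c)) 0 0 <= b' + N * b.
  move=> [i _ <-]; rewrite lform_pencil -subr_ge0.
  by have := hN i; rewrite /g /h; lra.
exists (c' + N *: c), (b' + N * b); split; first exact: lform_convex_hull.
apply/seteqP; split => x; rewrite HE FE.
  by move=> [[Px /= cx] /= c'x]; split => //=; rewrite lform_pencil cx c'x.
rewrite convex_hull_face// => -[m [w [a [wv a0 a1 ->]]]].
(* Equality in the combined form excludes [h i > 0] by [gN]; then [h i = 0], and the equality
   reduces to [g i = 0]. *)
have wE j : (w j *m c) 0 0 = b /\ (w j *m c') 0 0 = b'.
  have [[i _ <-] /=] := wv j; rewrite lform_pencil => e.
  have := h0 i; rewrite le_eqVlt => /orP[/eqP hi|/gN].
    by have := e; move: hi; rewrite /h => hi; split; nra.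
  by rewrite /g /h; lra.
split; first split.
- by exists m, w, a; split => // j; have [] := wv j.
- rewrite /= lform_sum; under eq_bigr => j _ do rewrite (wE j).1.
  by rewrite -mulr_suml a1 mul1r.
- rewrite /= lform_sum; under eq_bigr => j _ do rewrite (wE j).2.
  by rewrite -mulr_suml a1 mul1r.
Qed.

(* Rotate the supporting hyperplane [c = b] about the flat [c = b, c' = b']
   until it hits a new vertex; the points [x], [y] witness that the hyperplane
   never comes to contain all of [P]. *)
Lemma face_tilt P (c c' : 'cV[R]_d) (b b' : R) (x y : 'rV[R]_d) :
  polytope P -> (forall z, P z -> (z *m c) 0 0 <= b) ->
  (forall z, P z -> (z *m c) 0 0 = b -> (z *m c') 0 0 = b') ->
  affine_hull P x -> affine_hull P y ->
  (x *m c) 0 0 = (y *m c) 0 0 -> (x *m c') 0 0 != (y *m c') 0 0 ->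
  exists F, [/\ face P F, P `&` [set z | (z *m c) 0 0 = b] `<=` F,
    exists2 z, F z & (z *m c) 0 0 != b & ~ P `<=` F].
Proof.
move=> /polytope_range[n [v PE]] cb Fb' Px Py cxy c'xy.
have vP i : P (v i) by rewrite PE; apply: sub_convex_hull; exists i.
(* Otherwise pass to [- c']; if no vertex lies strictly on either side, [c'] is constant on the
   hull, against [x] and [y]. *)
wlog [i0 gi0] : c' b' Fb' c'xy / exists i, b' < (v i *m c') 0 0.
  move=> wlg; have [[i vi]|noti] := pselect (exists i, b' < (v i *m c') 0 0).
    by apply: (wlg c' b') => //; exists i.
  have [[i vi]|notj] := pselect (exists i, (v i *m c') 0 0 < b').
    have opp z : (z *m - c') 0 0 = - (z *m c') 0 0 by rewrite mulmxN mxE.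
    apply: (wlg (- c') (- b')).
    - by move=> z Pz zb; rewrite opp Fb'.
    - by rewrite !opp eqr_opp.
    - by exists i; rewrite opp ltrN2.
  have eqb' z : P z -> (z *m c') 0 0 = b'.
    rewrite PE => /sub_convex_affine_hull.
    apply: lform_affine_hull => _ [i _ <-]; apply/eqP.
    rewrite eq_le !leNgt; apply/andP; split; apply/negP => vi.
      by apply: noti; exists i.
    by apply: notj; exists i.
  by move: c'xy; rewrite !(lform_affine_hull eqb')// eqxx.
pose g i := (v i *m c') 0 0 - b'; pose h i := b - (v i *m c) 0 0.
have h0 i : 0 <= h i by rewrite subr_ge0 cb.
have gh i : 0 < g i -> 0 < h i.
  move=> gi; rewrite lt_def h0 andbT; apply/eqP => hi.
  suff : g i = 0 by move=> gi0'; rewrite gi0' ltxx in gi.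
  by rewrite /g Fb' ?subrr//; move: hi; rewrite /h; lra.
have gi0' : 0 < g i0 by rewrite subr_gt0.
(* The tilted inequality at [v i] reads [h i - t * g i >= 0]; the least ratio is the largest
   admissible [t], and [v j] is the vertex hit. *)
have [j gj jmin] := @arg_minP _ _ _ i0 (fun i => 0 < g i) (fun i => h i / g i) gi0'.
pose t := h j / g j.
have t0 : 0 < t by rewrite divr_gt0// gh.
have tg i : 0 <= h i - t * g i.
  have [gi|gi] := ltP 0 (g i).
    by rewrite subr_ge0 -ler_pdivlMr//; apply: jmin.
  by rewrite subr_ge0 (le_trans _ (h0 i))// pmulr_rle0.
have tj : h j - t * g j = 0 by rewrite /t divfK ?subrr// gt_eqF.
exists (P `&` [set z | (z *m (c + t *: c')) 0 0 = b + t * b']); split.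
- exists (c + t *: c'), (b + t * b'); split => //; rewrite PE.
  apply: lform_convex_hull => _ [i _ <-]; rewrite lform_pencil.
  by have := tg i; rewrite /g /h; lra.
- by move=> z [Pz /= zb]; split => //=; rewrite lform_pencil zb Fb'.
- exists (v j).
    by split => //=; rewrite lform_pencil; move: tj; rewrite /g /h; lra.
  by have := gh _ gj; rewrite subr_gt0 => /lt_eqF ->.
- move=> PF; have PF' z : P z -> (z *m (c + t *: c')) 0 0 = b + t * b'.
    by move=> /PF[].
  move/negP: c'xy; apply; apply/eqP.
  have := lform_affine_hull PF' Px; rewrite -(lform_affine_hull PF' Py).
  rewrite !lform_pencil cxy => /addrI; apply: mulfI.
  by rewrite gt_eqF.
Qed.

Lemma exists_facet P n : polytope P -> has_dim P n.+1 ->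
  exists F, kface n P F.
Proof.
move=> pP Pn; have [x0 [U [PU Un]]] := Pn.
(* Proper faces of growing dimension are built by induction on [m]. At [m = n] the dimension is [n]
   or [n.+1], and [n.+1] would force [F] to contain [P]. *)
suff large m : (m <= n)%N -> exists F i,
    [/\ face P F, has_dim F i, (m <= i)%N & ~ P `<=` F].
  have [F [i [fF Fi ni nPF]]] := large n (leqnn n).
  exists F; split => //.
  have := has_dim_le (face_sub fF) Fi Pn.
  rewrite leq_eqVlt => /orP[/eqP iE|]; last first.
    by rewrite ltnS => iln; have -> : n = i by apply/eqP; rewrite eqn_leq ni.
  exfalso; apply: nPF; rewrite iE in Fi.
  exact: face_dim_sub fF (face_sub fF) (@subset_refl _ _) Fi Pn.
have hullU u : u \in U -> affine_hull P (x0 + u).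
  by move=> uU; rewrite PU /= addrC addKr.
have Px0 : affine_hull P x0 by rewrite -[x0]addr0; apply/hullU/mem0v.
have dimF F : face P F -> F !=set0 -> exists i, has_dim F i.
  by move=> /(polytope_face pP); apply: polytope_has_dim.
elim: m => [_|m IH mn].
  (* The start tilts the empty face [0 = 1], on which the condition on [c'] is vacuous; any nonzero
     direction of [U] serves. *)
  have w0 : vpick U \notin 0%VS by rewrite memv0 vpick0 -dimv_eq0 Un.
  have [c' [_ c'w]] := lform_sep w0.
  have z0 (z : 'rV[R]_d) : (z *m 0) 0 0 = 0 :> R by rewrite mulmx0 mxE.
  have [||||F [fF _ [z Fz _] nPF]] :=
      @face_tilt P 0 c' 1 0 x0 (x0 + vpick U) pP _ _ Px0 (hullU _ (memv_pick _)).
  - by move=> z _; rewrite z0 ler01.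
  - by move=> z _; rewrite z0 => /eqP; rewrite eq_sym oner_eq0.
  - by rewrite !z0.
  - by rewrite lformD -subr_eq0 opprD addNKr oppr_eq0.
  have [i Fi] := dimF _ fF (ex_intro _ _ Fz).
  by exists F, i.
have [F [i [fF Fi mi nPF]]] := IH (ltnW mn).
have [mi'|im] := ltnP m i; first by exists F, i.
have {im mi}im : i = m by apply/eqP; rewrite eqn_leq im.
subst i; have FP := face_sub fF; case: fF => c [b [cb FE]].
have [x1 [V [FV Vm]]] := Fi.
have VU : (V <= U)%VS.
  by have := affine_hullS FP; rewrite FV PU => /flat_sub[].
have Fb x : affine_hull F x -> (x *m c) 0 0 = b.
  by apply: lform_affine_hull => y; rewrite FE => -[].
have hullV u : u \in V -> affine_hull F (x1 + u).
  by move=> uV; rewrite FV /= addrC addKr.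
have Fx1 : affine_hull F x1 by rewrite -[x1]addr0; apply/hullV/mem0v.
pose f : 'Hom('rV[R]_d, 'rV[R]_1) := linfun (mulmxr c).
(* The kernel of [c] on [U] has dimension at least [n], more than [m], the dimension of [V]. Moving
   along [w] keeps [c] fixed, while [c'] is to vanish on [V] but not at [w]. *)
have [w] : exists2 w, w \in (U :&: lker f)%VS & w \notin V.
  apply/subvPn/negP => /dimvS; rewrite Vm => Wm.
  have := limg_ker_dim f U; rewrite Un => dimU.
  have f1 : (\dim (f @: U) <= 1)%N.
    by apply: leq_trans (dimvS (subvf _)) _; rewrite dimvf.
  by have := leq_add Wm f1; rewrite dimU addn1 ltnS leqNgt mn.
rewrite memv_cap memv_ker lfunE /= => /andP[wU /eqP wc] wV.
have [c' [c'V c'w]] := lform_sep wV.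
have [|||F1 [fF1 FF1 [z F1z zb] nPF1]] :=
    @face_tilt P c c' b ((x1 *m c') 0 0) x0 (x0 + w) pP cb _ Px0 (hullU _ wU).
- move=> z Pz zb; have : affine_hull F z by apply: sub_affine_hull; rewrite FE.
  by rewrite FV /= => /c'V zx; rewrite -[in LHS](subrK x1 z) lformD zx add0r.
- by rewrite lformD wc [X in _ + X]mxE addr0.
- by rewrite lformD -subr_eq0 opprD addNKr oppr_eq0.
rewrite -FE in FF1; have [i F1i] := dimF _ fF1 (ex_intro _ _ F1z).
(* Equal dimensions would give [F1] inside [F], but [z] is in [F1] and off the hyperplane of [F]. *)
exists F1, i; split => //; rewrite ltn_neqAle (has_dim_le FF1 Fi F1i) andbT.
apply/eqP => mi; rewrite -mi in F1i.
have := face_dim_sub _ FF1 (face_sub fF1) Fi F1i.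
have fF : face P F by exists c, b.
by move=> /(_ fF) /(_ z F1z); rewrite FE => -[_ /= zb']; rewrite zb' eqxx in zb.
Qed.

(** Descend from facet to facet; [face_trans] makes the result a face of [P]. *)
Lemma exists_kface P n k : polytope P -> has_dim P n -> (k <= n)%N ->
  exists F, kface k P F.
Proof.
elim: n P => [|n IH] P pP Pn.
  by rewrite leqn0 => /eqP ->; exists P; split => //; apply: face_refl.
rewrite leq_eqVlt => /orP[/eqP ->|]; first by exists P; split => //; apply: face_refl.
rewrite ltnS => kn; have [F [fF Fn]] := exists_facet pP Pn.
have [H [fH Hk]] := IH F (polytope_face pP fF) Fn kn.
by exists H; split => //; apply: face_trans fF fH.
Qed.

End Dimension.

(* Descending through facets gives a chain of faces whose image under [phi] is
   a strict chain of faces of [Q]. *)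
Lemma face_embedding_dim (R : realType) (d e : nat) (P : set 'rV[R]_d)
    (Q : set 'rV[R]_e) (phi : set 'rV[R]_d -> set 'rV[R]_e) n :
  polytope P -> polytope Q -> has_dim P n ->
  (forall H, face P H -> face Q (phi H)) ->
  (forall H K, face P H -> face P K -> (phi H `<=` phi K <-> H `<=` K)) ->
  exists2 m, has_dim (phi P) m & (n <= m)%N.
Proof.
elim: n P => [|n IH] P pP pQ Pn phiQ phiS.
  have [m Pm] : exists m, has_dim (phi P) m.
    apply: polytope_has_dim; first by apply/polytope_face/phiQ/face_refl.
    (* An empty [phi P] would lie in [phi set0], forcing [P] itself to be empty. *)
    have [x Px] := has_dim_nonempty Pn; apply: contrapT => /nonemptyPn phi0.
    have [/(_ _ x Px)[]] := phiS _ _ (face_refl P) (face_set0 P).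
    by rewrite phi0; apply: sub0set.
  by exists m.
have [F [fF Fn]] := exists_facet pP Pn.
have fPF H : face F H -> face P H by apply: face_trans.
have [m Fm nm] := IH F (polytope_face pP fF) pQ Fn
  (fun H fH => phiQ H (fPF H fH)) (fun H K fH fK => phiS H K (fPF H fH) (fPF K fK)).
have FP : phi F `<=` phi P by have [_] := phiS _ _ fF (face_refl P); apply; apply: face_sub.
have [l Pl] : exists l, has_dim (phi P) l.
  apply: polytope_has_dim; first by apply/polytope_face/phiQ/face_refl.
  by have [x /FP] := has_dim_nonempty Fm; exists x.
exists l => //; apply: leq_ltn_trans nm _.
(* Equal dimensions would put [phi P] inside [phi F], hence [P] inside its facet [F]. *)
rewrite ltn_neqAle (has_dim_le FP Fm Pl) andbT; apply/eqP => ml.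
rewrite -ml in Pl.
have := face_dim_sub (phiQ _ fF) FP (face_sub (phiQ _ (face_refl P))) Fm Pl.
move=> /(phiS _ _ (face_refl P) fF) PF.
by have := has_dim_le PF Pn Fn; rewrite ltnn.
Qed.

(** * Images and preimages under affine maps *)

Section AffineMap.
Variables (R : realType) (d e : nat) (pi : 'rV[R]_d -> 'rV[R]_e).
Hypothesis pi_affine : affine_map pi.

Lemma affine_map_sum n (a : 'I_n -> R) (v : 'I_n -> 'rV[R]_d) :
  \sum_i a i = 1 -> pi (\sum_i a i *: v i) = \sum_i a i *: pi (v i).
Proof.
have [A [b piE]] := pi_affine => a1; rewrite piE.
under [RHS]eq_bigr => i _ do rewrite piE scalerDr scalemxAl.
by rewrite big_split /= -mulmx_suml -scaler_suml a1 scale1r.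
Qed.

Lemma polytope_image P : polytope P -> polytope (pi @` P).
Proof.
move=> [V fV ->]; exists (pi @` V); first exact: finite_image.
apply/seteqP; split => [_ [_ [n [v [a [vV a0 a1 ->]]]] <-]|].
  exists n, (pi \o v), a; split => //; last exact: affine_map_sum.
  by move=> i; exists (v i).
move=> _ [n [w [a [wV a0 a1 ->]]]].
have /choice[v vE] : forall i, exists x, V x /\ pi x = w i.
  by move=> i; have [x Vx <-] := wV i; exists x.
exists (\sum_i a i *: v i).
  by exists n, v, a; split => // i; have [] := vE i.
by rewrite affine_map_sum//; apply: eq_bigr => i _; have [_ ->] := vE i.
Qed.

(** Pull the supporting form back along [pi]; the translation part shifts the bound. *)
Lemma face_preimage P G : face (pi @` P) G -> face P (P `&` pi @^-1` G).
Proof.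
have [A [b0 piE]] := pi_affine => -[c [b [cb ->]]].
have cE x : (pi x *m c) 0 0 = (x *m (A *m c)) 0 0 + (b0 *m c) 0 0.
  by rewrite piE lformD mulmxA.
exists (A *m c), (b - (b0 *m c) 0 0); split => [x Px|].
  by rewrite lerBrDr -cE; apply: cb; exists x.
apply/seteqP; split => x.
  by move=> [Px [_ /= xb]]; split => //=; rewrite -xb cE addrK.
move=> [Px /= xb]; split => //; split; first by exists x.
by rewrite /= cE xb subrK.
Qed.

Lemma affine_hull_image A : affine_hull (pi @` A) = pi @` affine_hull A.
Proof.
apply/seteqP; split => [_ [n [w [a [wA a1 ->]]]]|].
  have /choice[v vE] : forall i, exists x, A x /\ pi x = w i.
    by move=> i; have [x Ax <-] := wA i; exists x.
  exists (\sum_i a i *: v i).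
    by exists n, v, a; split => // i; have [] := vE i.
  by rewrite affine_map_sum//; apply: eq_bigr => i _; have [_ ->] := vE i.
move=> _ [_ [n [v [a [vA a1 ->]]]] <-].
exists n, (pi \o v), a; split => //; last exact: affine_map_sum.
by move=> i; exists (v i).
Qed.

(** The directions of the image lie in the image of [U] under the linear part of [pi], and
    rank-nullity bounds its dimension. *)
Lemma has_dim_image A k l : has_dim A k -> has_dim (pi @` A) l -> (l <= k)%N.
Proof.
move=> [x [U [AU <-]]] [y [V [piAV <-]]]; have [B [b piE]] := pi_affine.
have piB u v : pi u - pi v = (u - v) *m B by rewrite !piE opprD addrACA subrr addr0 mulmxBl.
pose f : 'Hom('rV[R]_d, 'rV[R]_e) := linfun (mulmxr B).
rewrite -(limg_ker_dim f U); apply: leq_trans (leq_addl _ _); apply: dimvS.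
move: piAV; rewrite affine_hull_image AU => piAV.
suff /flat_sub[] : [set z | z - y \in V] `<=` [set z | z - pi x \in (f @: U)%VS].
  by [].
rewrite -piAV => _ [z /= zU <-]; rewrite piB.
by rewrite (_ : _ *m _ = f (z - x)) ?memv_img// lfunE.
Qed.

End AffineMap.

(** * Lifting a [k]-face of the projection *)

Theorem corollary2p8 (R : realType) (d e : nat) (P : set 'rV[R]_d)
    (pi : 'rV[R]_d -> 'rV[R]_e) (k : nat) (hP : polytope P)
    (hpi : affine_map pi)
    (hk : forall F : set 'rV[R]_d, kface k P F -> strictly_preserved pi P F) :
  forall G : set 'rV[R]_e, kface k (pi @` P) G ->
    exists2 F : set 'rV[R]_d, kface k P F & G = pi @` F.
Proof.
move=> G [fG Gk].
pose F' := P `&` pi @^-1` G; have fF' : face P F' by apply: face_preimage.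
have pF' := polytope_face hP fF'.
have GE : pi @` F' = G.
  apply/seteqP; split => [_ [x [_ Gx] <-]//|y Gy].
  by have [x Px xy] := face_sub fG Gy; exists x => //; split; rewrite //= xy.
have [m F'm] : exists m, has_dim F' m.
  apply: polytope_has_dim => //.
  by have [y] := has_dim_nonempty Gk; rewrite -GE => -[x]; exists x.
have km : (k <= m)%N by apply: (has_dim_image hpi F'm); rewrite GE.
have [F [fF Fk]] := exists_kface pF' F'm km.
have PFk : kface k P F by split => //; apply: face_trans fF' fF.
exists F => //; have [_ _ [fpiF [phi [[phiF _ _] phiS]]] _] := hk F PFk.
have pF := polytope_face pF' fF; have ppiF := polytope_image hpi pF.
have [l phil kl] := face_embedding_dim pF ppiF Fk phiF phiS.
have [x phix] := has_dim_nonempty phil.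
have phisub := face_sub (phiF _ (face_refl F)).
have [l' piFl'] := polytope_has_dim ppiF (ex_intro _ _ (phisub _ phix)).
have piFG : pi @` F `<=` G by rewrite -GE; apply/image_subset; apply: face_sub fF.
(* [l' <= k] since [pi(F)] lies in [G]; [k <= l <= l'] since [phi F] is a face of [pi(F)] of
   dimension [l]. *)
have l'k : l' = k.
  apply/eqP; rewrite eqn_leq (has_dim_le piFG piFl' Gk).
  exact: leq_trans kl (has_dim_le phisub phil piFl').
rewrite l'k in piFl'.
apply/seteqP; split; last exact: piFG.
exact: (face_dim_sub fpiF piFG (face_sub fG) piFl' Gk).
Qed.
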